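(* Consider the system $$x_{n+1}=\frac{y_nx_{n-1}+x_{n-1}+1}{y_nx_{n-1}},\qquad y_{n+1}=\frac{x_ny_{n-1}+y_{n-1}+1}{x_ny_{n-1}},\qquad n=0,1,\ldots,$$ with initial values $x_{-1},x_0,y_{-1},y_0\in(0,+\infty)$, and let $$\alpha=\frac{1+\sqrt[3]{19+3\sqrt{33}}+\sqrt[3]{19-3\sqrt{33}}}{3},$$ so that $(\alpha,\alpha)$ is the unique equilibrium point of the system in $(0,+\infty)\times(0,+\infty)$. Then the equilibrium point $(\alpha,\alpha)$ is globally asymptotically stable.
   Context: The number $\alpha$ is the real root of $\lambda^3-\lambda^2-\lambda-1=0$. An equilibrium point is a pair $(\bar x,\bar y)$ such that the constant sequences $x_n=\bar x$, $y_n=\bar y$ solve the system. The equilibrium $(\alpha,\alpha)$ is locally stable if for every $\varepsilon>0$ there is $\delta>0$ such that positive initial values with $|x_i-\alpha|<\delta$, $|y_i-\alpha|<\delta$ for $i=-1,0$ yield $|x_n-\alpha|<\varepsilon$ and $|y_n-\alpha|<\varepsilon$ for all $n\ge -1$. It is locally asymptotically stable if it is locally stable and there is $r>0$ such that positive initial values with $|x_i-\alpha|<r$, $|y_i-\alpha|<r$ for $i=-1,0$ yield $(x_n,y_n)\to(\alpha,\alpha)$. It is globally asymptotically stable if it is locally asymptotically stable and $(x_n,y_n)\to(\alpha,\alpha)$ for all initial values in $(0,+\infty)$. *)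

(* Defs.v *)
From Stdlib Require Import Reals.
From Coquelicot Require Import Coquelicot.
Open Scope R_scope.

(** Sequences are indexed by [nat] with a shift by one: [x k] stands for
    x_{k-1}, so [x 0] and [x 1] are the initial values x_{-1} and x_0.
    Division is total in Rocq; for positive initial values all terms stay
    positive, so no denominator below ever vanishes. *)
Definition solution (x y : nat -> R) : Prop :=
  forall n : nat,
    x (S (S n)) = (y (S n) * x n + x n + 1) / (y (S n) * x n) /\
    y (S (S n)) = (x (S n) * y n + y n + 1) / (x (S n) * y n).

Definition positive_init (x y : nat -> R) : Prop :=
  0 < x 0%nat /\ 0 < x 1%nat /\ 0 < y 0%nat /\ 0 < y 1%nat.

Definition init_near (xb yb d : R) (x y : nat -> R) : Prop :=
  Rabs (x 0%nat - xb) < d /\ Rabs (x 1%nat - xb) < d /\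
  Rabs (y 0%nat - yb) < d /\ Rabs (y 1%nat - yb) < d.

Definition equilibrium (xb yb : R) : Prop :=
  solution (fun _ => xb) (fun _ => yb).

Definition converges_to (xb yb : R) (x y : nat -> R) : Prop :=
  is_lim_seq x (Finite xb) /\ is_lim_seq y (Finite yb).

Definition locally_stable (xb yb : R) : Prop :=
  forall eps : R, 0 < eps ->
    exists delta : R, 0 < delta /\
      forall x y : nat -> R,
        solution x y -> positive_init x y -> init_near xb yb delta x y ->
        forall n : nat, Rabs (x n - xb) < eps /\ Rabs (y n - yb) < eps.

Definition locally_asymptotically_stable (xb yb : R) : Prop :=
  locally_stable xb yb /\
  exists r : R, 0 < r /\
    forall x y : nat -> R,
      solution x y -> positive_init x y -> init_near xb yb r x y ->
      converges_to xb yb x y.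

Definition globally_asymptotically_stable (xb yb : R) : Prop :=
  locally_asymptotically_stable xb yb /\
  forall x y : nat -> R,
    solution x y -> positive_init x y -> converges_to xb yb x y.

(** [Rpower] is the real power only for a positive base; both bases in
    [alpha] are positive, since 9 * 33 < 19 ^ 2. *)
Definition cbrt (z : R) : R := Rpower z (1 / 3).

Definition alpha : R :=
  (1 + cbrt (19 + 3 * sqrt 33) + cbrt (19 - 3 * sqrt 33)) / 3.

(* Main.v *)
(** With [T] the sequence of partial products of x_{-1}, y_0, x_1, y_2, ...,
    the system says that [T] satisfies the tribonacci recurrence.  Factoring
    [t^3 - t^2 - t - 1 = (t - alpha) (t^2 + (alpha - 1) t + 1 / alpha)], the
    differences d_n = T_{n+1} - alpha T_n satisfy a second order linear
    recurrence whose characteristic roots are complex of modulus squared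
    [1 / alpha], so the positive definite form
    d_{n+1}^2 + (alpha - 1) d_{n+1} d_n + d_n^2 / alpha is multiplied by
    [1 / alpha] at each step.  Dividing it by T_n^2 gives a Lyapunov function of
    two consecutive terms, which is multiplied by [1 / (alpha * x_n ^ 2)] at
    each step; this factor is less than 1 as soon as [1 <= x_n].  The same
    applies to the chain y_{-1}, x_0, y_1, x_2, ... *)

Require Import Defs.
From Stdlib Require Import Reals Lra.
From Coquelicot Require Import Coquelicot.
Open Scope R_scope.

(** * Cube roots and the cubic equation of [alpha] *)

Lemma cbrt_pos (z : R) : 0 < cbrt z.
Proof. apply exp_pos. Qed.

Lemma cbrt_cube (z : R) : 0 < z -> cbrt z ^ 3 = z.
Proof.
  intros Hz. unfold cbrt.
  rewrite <- Rpower_pow by apply exp_pos. rewrite Rpower_mult.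
  replace (1 / 3 * INR 3) with 1 by (simpl; field).
  now apply Rpower_1.
Qed.

Lemma cbrt_mult (u v : R) : 0 < u -> 0 < v -> cbrt u * cbrt v = cbrt (u * v).
Proof. intros Hu Hv. unfold cbrt. now rewrite Rpower_mult_distr. Qed.

Lemma cbrt_64 : cbrt 64 = 4.
Proof.
  assert (H := cbrt_cube 64 ltac:(lra)). assert (Hp := cbrt_pos 64). nra.
Qed.

(** Cardano's formula: the two cube roots have product 4 and their cubes sum to 38, so their sum s
    satisfies s^3 = 12 s + 38, which is the cubic after the substitution (1 + s) / 3. *)
Lemma alpha_cubic : alpha ^ 3 = alpha ^ 2 + alpha + 1.
Proof.
  assert (Hs : sqrt 33 * sqrt 33 = 33) by (apply sqrt_sqrt; lra).
  assert (Hs0 : 0 <= sqrt 33) by apply sqrt_pos.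
  assert (Hs6 : sqrt 33 < 6) by nra.
  assert (Hp := cbrt_cube (19 + 3 * sqrt 33) ltac:(lra)).
  assert (Hq := cbrt_cube (19 - 3 * sqrt 33) ltac:(lra)).
  assert (Hpq := cbrt_mult (19 + 3 * sqrt 33) (19 - 3 * sqrt 33)
                   ltac:(lra) ltac:(lra)).
  replace ((19 + 3 * sqrt 33) * (19 - 3 * sqrt 33)) with 64 in Hpq by nra.
  rewrite cbrt_64 in Hpq. unfold alpha.
  set (p := cbrt (19 + 3 * sqrt 33)) in *.
  set (q := cbrt (19 - 3 * sqrt 33)) in *.
  assert (Hsum : (p + q) ^ 3 = 38 + 12 * (p + q)).
  { replace ((p + q) ^ 3) with (p ^ 3 + q ^ 3 + 3 * (p * q) * (p + q)) by ring.
    rewrite Hp, Hq, Hpq. ring. }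
  replace (((1 + p + q) / 3) ^ 3)
    with ((1 + 3 * (p + q) + 3 * (p + q) ^ 2 + (p + q) ^ 3) / 27) by field.
  rewrite Hsum. field.
Qed.

Lemma alpha_pos : 0 < alpha.
Proof.
  unfold alpha.
  assert (Hp := cbrt_pos (19 + 3 * sqrt 33)).
  assert (Hq := cbrt_pos (19 - 3 * sqrt 33)). lra.
Qed.

Lemma alpha_gt_1 : 1 < alpha.
Proof. assert (H := alpha_cubic). assert (H0 := alpha_pos). nra. Qed.

Lemma alpha_lt_2 : alpha < 2.
Proof. assert (H := alpha_cubic). assert (H0 := alpha_pos). nra. Qed.

Lemma alpha_inv : / alpha = alpha ^ 2 - alpha - 1.
Proof.
  assert (H := alpha_cubic). assert (H0 := alpha_pos).
  apply (Rmult_eq_reg_l alpha); [| lra].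
  rewrite Rinv_r by lra. lra.
Qed.

Lemma alpha_inv_lt_1 : 0 < / alpha < 1.
Proof.
  assert (H := alpha_gt_1). split.
  - apply Rinv_0_lt_compat; lra.
  - rewrite <- Rinv_1. apply Rinv_lt_contravar; lra.
Qed.

(** * The quadratic form and the Lyapunov function *)

Definition quad (a b : R) : R := a ^ 2 + (alpha - 1) * a * b + b ^ 2 / alpha.

(** Since [4 / alpha - (alpha - 1) ^ 2 = ((alpha - 1) ^ 2 + 2) / alpha]. *)
Lemma quad_lower_bound (a b : R) : b ^ 2 <= 2 * alpha * quad a b.
Proof.
  assert (H := alpha_cubic). assert (H0 := alpha_pos).
  assert (E : 2 * (2 * alpha * quad a b) =
    alpha * (2 * a + (alpha - 1) * b) ^ 2 + ((alpha - 1) ^ 2 + 2) * b ^ 2).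
  { replace ((alpha - 1) ^ 2 + 2) with (4 - alpha * (alpha - 1) ^ 2) by lra.
    unfold quad. field. lra. }
  assert (0 <= alpha * (2 * a + (alpha - 1) * b) ^ 2)
    by (apply Rmult_le_pos; [lra | apply pow2_ge_0]).
  assert (0 <= (alpha - 1) ^ 2 * b ^ 2)
    by (apply Rmult_le_pos; apply pow2_ge_0).
  lra.
Qed.

Lemma quad_nonneg (a b : R) : 0 <= quad a b.
Proof.
  assert (H := quad_lower_bound a b). assert (H0 := alpha_pos).
  assert (H1 := pow2_ge_0 b). nra.
Qed.

(** With z a complex root of t^2 + (alpha - 1) t + 1 / alpha, [quad a b] is |a - z b|^2, and the
    step multiplies a - z b by the conjugate of z. *)
Lemma quad_step (a b : R) :
  quad (- (alpha - 1) * a - b / alpha) a = quad a b / alpha.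
Proof. assert (H := alpha_pos). unfold quad. field. lra. Qed.

Lemma quad_scale (k a b : R) : quad (k * a) (k * b) = k ^ 2 * quad a b.
Proof. assert (H := alpha_pos). unfold quad. field. lra. Qed.

(** The three terms contribute at most 9, 3 and 1 times [d ^ 2], as [alpha - 1] and [/ alpha] lie
    below 1. *)
Lemma quad_upper_bound (a b d : R) :
  Rabs a <= 3 * d -> Rabs b <= d -> quad a b <= 13 * d ^ 2.
Proof.
  intros Ha Hb.
  assert (Hi := alpha_inv_lt_1). assert (H1 := alpha_gt_1).
  assert (H2 := alpha_lt_2).
  assert (Ha0 := Rabs_pos a). assert (Hb0 := Rabs_pos b).
  assert (Hab : Rabs a * Rabs b <= 3 * d * d)
    by (apply Rmult_le_compat; assumption).
  assert (Haa : a ^ 2 <= 9 * d ^ 2) by (rewrite <- pow2_abs; nra).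
  assert (Hbb : b ^ 2 <= d ^ 2) by (rewrite <- pow2_abs; nra).
  assert (Hm : a * b <= 3 * d * d)
    by (eapply Rle_trans; [apply Rle_abs | now rewrite Rabs_mult]).
  assert (Hmid : (alpha - 1) * a * b <= 3 * d * d) by nra.
  assert (Hlast : b ^ 2 / alpha <= d ^ 2).
  { unfold Rdiv. assert (H0 := pow2_ge_0 b). nra. }
  unfold quad. lra.
Qed.

(** The form [quad] of (d_{n+1}, d_n), divided by T_n^2, where [u = x_n] and
    [v = y_{n+1}]. *)
Definition lyap (u v : R) : R := quad ((v - alpha) * u) (u - alpha).

Lemma lyap_step (u v : R) : 0 < u -> 0 < v ->
  lyap v ((v * u + u + 1) / (v * u)) = / (alpha * u ^ 2) * lyap u v.
Proof.
  intros Hu Hv. assert (Ha := alpha_pos). unfold lyap.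
  (* The second order recurrence for d_{n+2}, divided by T_n. *)
  assert (E : v * u + u + 1 - alpha * (v * u) =
    - (alpha - 1) * ((v - alpha) * u) - (u - alpha) / alpha).
  { assert (H := alpha_cubic). unfold Rdiv. rewrite alpha_inv. lra. }
  (* Passing from division by T_n to division by T_{n+1} costs the factor [/ u]. *)
  replace (((v * u + u + 1) / (v * u) - alpha) * v)
    with (/ u * (- (alpha - 1) * ((v - alpha) * u) - (u - alpha) / alpha))
    by (rewrite <- E; field; lra).
  replace (quad _ (v - alpha)) with
    (quad (/ u * (- (alpha - 1) * ((v - alpha) * u) - (u - alpha) / alpha))
       (/ u * ((v - alpha) * u))) by (f_equal; field; lra).
  rewrite quad_scale, quad_step. field. lra.
Qed.

Lemma lyap_contract (u v : R) : 1 <= u -> 0 < v ->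
  lyap v ((v * u + u + 1) / (v * u)) <= / alpha * lyap u v.
Proof.
  intros Hu Hv. rewrite lyap_step by lra.
  apply Rmult_le_compat_r; [apply quad_nonneg |].
  assert (Ha := alpha_pos). assert (Hu2 : 1 <= u ^ 2) by nra.
  apply Rinv_le_contravar; nra.
Qed.

(** * Decay along solutions *)

(** Both chains alternate between [x] and [y], so from [n] to [S n] the two summands exchange
    places; their sum hides the parity of [n]. *)
Definition energy (x y : nat -> R) (n : nat) : R :=
  lyap (x n) (y (S n)) + lyap (y n) (x (S n)).

Lemma energy_bound (x y : nat -> R) (n : nat) :
  (x n - alpha) ^ 2 <= 4 * energy x y n /\
  (y n - alpha) ^ 2 <= 4 * energy x y n.
Proof.
  assert (Ha := alpha_pos). assert (H2 := alpha_lt_2). unfold energy, lyap.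
  assert (Hx := quad_lower_bound ((y (S n) - alpha) * x n) (x n - alpha)).
  assert (Hy := quad_lower_bound ((x (S n) - alpha) * y n) (y n - alpha)).
  assert (Hx0 := quad_nonneg ((y (S n) - alpha) * x n) (x n - alpha)).
  assert (Hy0 := quad_nonneg ((x (S n) - alpha) * y n) (y n - alpha)).
  split; nra.
Qed.

Lemma recurrence_gt_1 (u v : R) : 0 < u -> 0 < v ->
  1 < (v * u + u + 1) / (v * u).
Proof.
  intros Hu Hv. assert (H : 0 < v * u) by nra.
  apply (Rmult_lt_reg_r (v * u)); [exact H |].
  unfold Rdiv. rewrite Rmult_assoc, Rinv_l; lra.
Qed.

Lemma solution_pos (x y : nat -> R) : solution x y -> positive_init x y ->
  forall n, 0 < x n /\ 0 < y n.
Proof.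
  intros Hs (Hx0 & Hx1 & Hy0 & Hy1) n.
  enough (H : (0 < x n /\ 0 < y n) /\ (0 < x (S n) /\ 0 < y (S n)))
    by apply H.
  induction n as [| n [[Hx Hy] [Hx' Hy']]]; [tauto |].
  destruct (Hs n) as [Ex Ey].
  assert (Gx := recurrence_gt_1 (x n) (y (S n)) Hx Hy').
  assert (Gy := recurrence_gt_1 (y n) (x (S n)) Hy Hx').
  rewrite Ex, Ey. repeat split; lra.
Qed.

Lemma solution_gt_1 (x y : nat -> R) : solution x y -> positive_init x y ->
  forall n, 1 < x (S (S n)) /\ 1 < y (S (S n)).
Proof.
  intros Hs Hp n. destruct (Hs n) as [-> ->].
  assert (H := solution_pos x y Hs Hp n).
  assert (H' := solution_pos x y Hs Hp (S n)).
  split; apply recurrence_gt_1; tauto.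
Qed.

(** The start [m] is 2 for arbitrary positive initial values, which may lie below 1, and 0 for
    initial values near [alpha]. *)
Lemma energy_decay (x y : nat -> R) (m : nat) :
  solution x y -> (forall n, 1 <= x (n + m)%nat /\ 1 <= y (n + m)%nat) ->
  forall n, energy x y (n + m) <= energy x y m * (/ alpha) ^ n.
Proof.
  intros Hs Hge n. assert (Hi := alpha_inv_lt_1).
  induction n as [| n IH]; [simpl; lra |].
  destruct (Hge n) as [Hx Hy]. destruct (Hge (S n)) as [Hx' Hy'].
  destruct (Hs (n + m)%nat) as [Ex Ey]. simpl Nat.add in *.
  assert (Lx := lyap_contract (x (n + m)%nat) (y (S (n + m))) Hx ltac:(lra)).
  assert (Ly := lyap_contract (y (n + m)%nat) (x (S (n + m))) Hy ltac:(lra)).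
  rewrite <- Ex in Lx. rewrite <- Ey in Ly.
  apply Rle_trans with (/ alpha * energy x y (n + m)).
  - unfold energy. lra.
  - simpl pow. nra.
Qed.

(** * Global convergence *)

Lemma is_lim_seq_of_sqr_bound (u b : nat -> R) (l : R) :
  (forall n, (u n - l) ^ 2 <= b n) -> is_lim_seq b 0 -> is_lim_seq u l.
Proof.
  intros Hb Hlim. apply is_lim_seq_spec. intros eps.
  assert (He : 0 < eps ^ 2) by (apply pow_lt, cond_pos).
  apply is_lim_seq_spec in Hlim.
  destruct (Hlim (mkposreal _ He)) as [N HN]. exists N. intros n Hn.
  specialize (HN n Hn). simpl pos in HN. rewrite Rminus_0_r in HN.
  apply Rabs_def2 in HN. specialize (Hb n).
  rewrite <- (Rabs_pos_eq eps) by apply Rlt_le, cond_pos.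
  apply Rsqr_lt_abs_0. rewrite !Rsqr_pow2. lra.
Qed.

Lemma solution_converges (x y : nat -> R) :
  solution x y -> positive_init x y -> converges_to alpha alpha x y.
Proof.
  intros Hs Hp. assert (Hi := alpha_inv_lt_1).
  assert (Hdecay : forall n,
    energy x y (n + 2) <= energy x y 2 * (/ alpha) ^ n).
  { apply energy_decay; [exact Hs |]. intros n. rewrite Nat.add_comm. simpl.
    assert (H := solution_gt_1 x y Hs Hp n). lra. }
  assert (Hlim : is_lim_seq (fun n => 4 * energy x y 2 * (/ alpha) ^ n) 0).
  { replace (Finite 0) with (Rbar_mult (4 * energy x y 2) 0)
      by (simpl; f_equal; ring).
    apply is_lim_seq_scal_l, is_lim_seq_geom. rewrite Rabs_pos_eq; lra. }
  split; apply (is_lim_seq_incr_n _ 2);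
    (eapply is_lim_seq_of_sqr_bound; [| exact Hlim]);
    intros n; assert (H := energy_bound x y (n + 2)%nat);
    specialize (Hdecay n); simpl in *; lra.
Qed.

(** * Local stability *)

Lemma lyap_near (u v d : R) : d <= 1 ->
  Rabs (u - alpha) < d -> Rabs (v - alpha) < d -> 1 <= u ->
  lyap u v <= 13 * d ^ 2.
Proof.
  intros Hd Hu Hv H1. apply quad_upper_bound; [| lra].
  assert (H2 := alpha_lt_2). assert (H0 := Rabs_pos (v - alpha)).
  assert (Hu3 : u <= 3) by (apply Rabs_def2 in Hu; lra).
  rewrite Rabs_mult, (Rabs_pos_eq u) by lra. nra.
Qed.

Lemma alpha_locally_stable : locally_stable alpha alpha.
Proof.
  intros eps Heps. assert (H1 := alpha_gt_1). assert (H2 := alpha_lt_2).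
  assert (Hi := alpha_inv_lt_1).
  (* The bound [alpha - 1] keeps the initial values at least 1, so that the energy decays from index
     0; [eps / 11] gives 4 * 26 * d^2 < 121 * d^2 <= eps^2. *)
  set (d := Rmin (alpha - 1) (eps / 11)).
  assert (Hda : d <= alpha - 1) by apply Rmin_l.
  assert (Hde : d <= eps / 11) by apply Rmin_r.
  assert (Hd0 : 0 < d) by (apply Rmin_pos; lra).
  exists d. split; [exact Hd0 |].
  intros x y Hs Hp (Hx0 & Hx1 & Hy0 & Hy1) n.
  assert (Hge : forall u, Rabs (u - alpha) < d -> 1 <= u)
    by (intros u Hu; apply Rabs_def2 in Hu; lra).
  assert (Hdecay : energy x y (n + 0) <= energy x y 0 * (/ alpha) ^ n).
  { apply energy_decay; [exact Hs |]. intros k. rewrite Nat.add_0_r.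
    destruct k as [| [| k]]; [split; auto | split; auto |].
    assert (H := solution_gt_1 x y Hs Hp k). lra. }
  rewrite Nat.add_0_r in Hdecay.
  assert (Hpow : (/ alpha) ^ n <= 1)
    by (rewrite <- (pow1 n); apply pow_incr; lra).
  assert (Hinit : energy x y 0 <= 26 * d ^ 2).
  { unfold energy.
    assert (Lx := lyap_near (x 0%nat) (y 1%nat) d ltac:(lra) Hx0 Hy1 (Hge _ Hx0)).
    assert (Ly := lyap_near (y 0%nat) (x 1%nat) d ltac:(lra) Hy0 Hx1 (Hge _ Hy0)).
    lra. }
  assert (Hpos : 0 <= energy x y 0)
    by (apply Rplus_le_le_0_compat; apply quad_nonneg).
  assert (Hn : 4 * energy x y n < eps ^ 2) by nra.
  assert (Hb := energy_bound x y n).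
  rewrite <- (Rabs_pos_eq eps) by lra.
  split; apply Rsqr_lt_abs_0; rewrite !Rsqr_pow2; lra.
Qed.

(** * The equilibrium and its uniqueness *)

Lemma alpha_equilibrium : equilibrium alpha alpha.
Proof.
  assert (Ha := alpha_pos). assert (H := alpha_cubic).
  assert (E : alpha = (alpha * alpha + alpha + 1) / (alpha * alpha)).
  { apply (Rmult_eq_reg_r (alpha * alpha)); [| nra].
    unfold Rdiv. rewrite Rmult_assoc, Rinv_l by nra. lra. }
  intros n. split; exact E.
Qed.

Theorem theorem4 :
  (0 < alpha /\ equilibrium alpha alpha /\
   (forall xb yb : R, 0 < xb -> 0 < yb -> equilibrium xb yb ->
      xb = alpha /\ yb = alpha)) /\
  globally_asymptotically_stable alpha alpha.
Proof.
  split.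
  - split; [exact alpha_pos |]. split; [exact alpha_equilibrium |].
    intros xb yb Hx Hy He.
    (* A positive equilibrium is a constant solution, hence equal to its limit [alpha]. *)
    destruct (solution_converges _ _ He) as [Lx Ly];
      [now repeat split |].
    apply is_lim_seq_unique in Lx, Ly. rewrite Lim_seq_const in Lx, Ly.
    split; congruence.
  - split; [| exact solution_converges].
    split; [exact alpha_locally_stable |].
    exists 1. split; [lra |].
    intros x y Hs Hp _. now apply solution_converges.
Qed.
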